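(* For all positive integers $n$ and $r$, the colored derangement polynomial $d_{n,r}$ satisfies $\mathcal{I}_n(d_{n,r})\prec d_{n,r}$. In particular, $d_{n,r}$ is real-rooted and alternatingly increasing.
   Context: An $r$-colored permutation of $[n]$ is a pair $(\pi,z)\in\mathfrak{S}_n\times\{0,1,\dots,r-1\}^n$. An index $k\in[n]$ is an excedance of $(\pi,z)$ if $\pi_k>k$, or $\pi_k=k$ and $z_k>0$; $\mathrm{exc}(\pi,z)$ is the number of excedances. A derangement is an $r$-colored permutation with no index $k$ such that $\pi_k=k$ and $z_k=0$; $\mathfrak{D}_{n,r}$ denotes the set of derangements. The colored derangement polynomial is $d_{n,r}(x)=\sum_{(\pi,z)\in\mathfrak{D}_{n,r}}x^{\mathrm{exc}(\pi,z)}$. $\mathcal{I}_n(p)(x)=x^np(1/x)$. We write $p\prec q$ if $p,q$ are real-rooted, their zeros interlace (a zero of each lies between any two zeros of the other, counted with multiplicity), and $p'q-pq'\le0$ on $\mathbb{R}$; the zero polynomial is real-rooted and $0\prec p$, $p\prec0$ for all real-rooted $p$. A polynomial $p=p_0+\cdots+p_nx^n$ is alternatingly increasing if $0\le p_0\le p_n\le p_1\le p_{n-1}\le\cdots\le p_{\lfloor (n+1)/2\rfloor}$. *)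

(* Defs.v *)
From HB Require Import structures.
From mathcomp Require Import all_boot all_order all_fingroup all_algebra.
From mathcomp Require Import reals complex.

Set Implicit Arguments.
Unset Strict Implicit.
Unset Printing Implicit Defensive.

Import Order.TTheory GRing.Theory Num.Theory.
Local Open Scope ring_scope.

(* [n] is modelled by 'I_n = {0, ..., n-1}; excedances and fixed points only
   depend on the order and equality of indices, not on this shift. *)
Definition colored_perm (n r : nat) : finType :=
  ({perm 'I_n} * {ffun 'I_n -> 'I_r})%type.

Definition is_excedance (n r : nat) (w : colored_perm n r) (k : 'I_n) : bool :=
  (k < w.1 k)%N || ((w.1 k == k) && (0 < w.2 k)%N).

Definition exc (n r : nat) (w : colored_perm n r) : nat :=
  #|[set k | is_excedance w k]|.

Definition is_derangement (n r : nat) (w : colored_perm n r) : bool :=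
  ~~ [exists k, (w.1 k == k) && (w.2 k == 0%N :> nat)].

Definition derangement_poly (R : realType) (n r : nat) : {poly R} :=
  \sum_(w : colored_perm n r | is_derangement w) 'X^(exc w).

(* x^n p(1/x), for p of degree at most n (see [horner_reversal]). *)
Definition reversal (R : realType) (n : nat) (p : {poly R}) : {poly R} :=
  \sum_(i < n.+1) p`_i *: 'X^(n - i).

Lemma horner_reversal (R : realType) (n : nat) (p : {poly R}) (x : R) :
  (size p <= n.+1)%N -> x != 0 -> (reversal n p).[x] = x ^+ n * p.[x^-1].
Proof.
move=> sz_p x0; rewrite (horner_coef_wide _ sz_p) mulr_sumr horner_sum.
apply: eq_bigr => i _; rewrite hornerZ hornerXn mulrCA; congr (_ * _).
by rewrite exprVn -expfB_cond // (negPf x0) add0n -ltnS.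
Qed.

(* For p != 0 all complex zeros have to be real. *)
Definition real_rooted (R : realType) (p : {poly R}) : Prop :=
  p = 0 \/
  forall z : complex R, root (map_poly (real_complex R) p) z -> complex.Im z = 0.

(* s lists the real zeros of p in increasing order, with multiplicity
   (only meaningful for p != 0). *)
Definition is_zero_seq (R : realType) (p : {poly R}) (s : seq R) : Prop :=
  sorted <=%R s /\ forall x : R, count_mem x s = mup x p.

(* For increasing s and t: any two consecutive entries of s enclose an entry
   of t.  Multiplicities are respected, since u is a subsequence of t: no entry
   of t is used more often than it occurs, so an entry of multiplicity m in s
   has multiplicity at least m - 1 in t. *)
Definition separated_by (R : realType) (s t : seq R) : Prop :=
  exists u : seq R, [/\ subseq u t, size u = (size s).-1
    & forall i, (i.+1 < size s)%N -> s`_i <= u`_i <= s`_i.+1].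

Definition interlacing (R : realType) (p q : {poly R}) : Prop :=
  exists s t : seq R, [/\ is_zero_seq p s, is_zero_seq q t,
    separated_by s t & separated_by t s].

Definition prec (R : realType) (p q : {poly R}) : Prop :=
  [/\ real_rooted p, real_rooted q &
    [\/ p = 0, q = 0 |
      interlacing p q /\ forall x : R, (p^`() * q - p * q^`()).[x] <= 0]].

(* 0, n, 1, n - 1, 2, ...; its n-th term is (n + 1)./2. *)
Definition alt_index (n k : nat) : nat :=
  if odd k then (n - k./2)%N else k./2.

(* The coefficients are those of p seen as p_0 + ... + p_n x^n, so p_n may
   vanish.  The path is 0 <= p_0 <= p_n <= p_1 <= ... <= p_((n + 1)./2). *)
Definition alternatingly_increasing (R : realType) (n : nat) (p : {poly R}) :
    Prop :=
  (size p <= n.+1)%N /\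
  path <=%R 0 [seq p`_(alt_index n k) | k <- iota 0 n.+1].

(* Main.v *)
Require Import Defs.
From mathcomp Require Import all_boot all_order all_fingroup all_algebra.
From mathcomp Require Import ring lra zify.
From mathcomp Require Import boolp classical_sets reals.
From mathcomp Require Import polyrcf complex.

(* Let P_n(c; x) be the sum of c^fix(s) x^exc(s) over the permutations s of [n],
   and c = (r - 1) / r.  Then I_n(d_{n,r}) = r^n P_n(c; x), and
     P_{n+1} = (c + n x) P_n + x (1 - x) P_n' + (1 - c) n x P_{n-1},
     (d/dc) P_n(c; x) = n P_{n-1}(c; x).
   The first identity shows, by induction on n, that P_n has n - 1 simple zeros
   strictly interlaced by those of P_{n-1}.  With the second one, it follows that
   every zero of P_n(c; x) decreases as c grows: the i-th zero f_i(c) satisfies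
   a_i <= f_i(c) <= d_i, with a_i the zeros of the Eulerian polynomial P_n(1; x)
   and d_i those of the derangement polynomial P_n(0; x).  Both end configurations
   are invariant under x -> 1/x (up to the zero at 0), so the zeros 1/f_i(c) of
   d_{n,r} are caught in between those of I_n(d_{n,r}).
   The coefficient inequalities follow directly from the recurrence. *)

Set Implicit Arguments.
Unset Strict Implicit.
Unset Printing Implicit Defensive.
Import Order.TTheory GRing.Theory Num.Theory.
Local Open Scope ring_scope.

(** * Simple real zeros *)

Definition increasing_upto (R : realType) (m : nat) (f : nat -> R) : Prop :=
  forall i j, (i < j)%N -> (j < m)%N -> f i < f j.

(** Only [f 0, ..., f (m - 1)] matter. The positive leading coefficient fixes the sign of [p] in
    every gap between zeros. *)
Definition simple_zeros (R : realType) (p : {poly R}) (m : nat) (f : nat -> R) :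
    Prop :=
  [/\ increasing_upto m f, 0 < lead_coef p
    & p = lead_coef p *: \prod_(i < m) ('X - (f i)%:P)].

Lemma mulr_signACA (R : realType) (a : nat) (x y : R) :
  (-1) ^+ a * x * ((-1) ^+ a * y) = x * y.
Proof. by rewrite mulrACA -exprD addnn -signr_odd odd_double mul1r. Qed.

Lemma prod_sign (R : realType) (m k : nat) (f : nat -> R) (x : R) :
  (k <= m)%N -> (forall i, (i < k)%N -> f i < x) ->
  (forall i, (k <= i < m)%N -> x < f i) ->
  0 < (-1) ^+ (m - k) * \prod_(i < m) (x - f i).
Proof.
move=> km fl fg; rewrite -(big_mkord xpredT (fun i => x - f i)).
rewrite (big_cat_nat (n := k)) //= mulrCA mulr_gt0 //.
  rewrite big_nat_cond; apply: prodr_gt0 => i /andP[/andP[_ ik] _].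
  by rewrite subr_gt0 fl.
rewrite -(prodr_const_nat k m (-1)) -big_split /= big_nat_cond.
apply: prodr_gt0 => i /andP[kim _].
by rewrite mulN1r opprB subr_gt0 fg.
Qed.

Lemma simple_zeros_horner (R : realType) (p : {poly R}) m f x :
  simple_zeros p m f -> p.[x] = lead_coef p * \prod_(i < m) (x - f i).
Proof.
case=> _ _ {1}->; rewrite hornerZ horner_prod; congr (_ * _).
by apply: eq_bigr => i _; rewrite hornerXsubC.
Qed.

Lemma simple_zeros_sign (R : realType) (p : {poly R}) m k f x :
  simple_zeros p m f -> (k <= m)%N -> (forall i, (i < k)%N -> f i < x) ->
  (forall i, (k <= i < m)%N -> x < f i) -> 0 < (-1) ^+ (m - k) * p.[x].
Proof.
move=> pf km fl fg; rewrite (simple_zeros_horner x pf) mulrCA.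
by case: pf => _ l0 _; rewrite mulr_gt0 // prod_sign.
Qed.

Lemma simple_zeros_root (R : realType) (p : {poly R}) m f i :
  simple_zeros p m f -> (i < m)%N -> p.[f i] = 0.
Proof.
move=> pf im; rewrite (simple_zeros_horner _ pf) (bigD1 (Ordinal im)) //=.
by rewrite subrr mul0r mulr0.
Qed.

Lemma simple_zeros_size (R : realType) (p : {poly R}) m f :
  simple_zeros p m f -> size p = m.+1.
Proof.
case=> _ l0 ->; rewrite size_scale ?gt_eqF //.
by rewrite (size_prod_XsubC _ (fun i : 'I_m => f i)) /index_enum -enumT size_enum_ord.
Qed.

Lemma simple_zeros_deriv_sign (R : realType) (p : {poly R}) m k f :
  simple_zeros p m f -> (k < m)%N -> 0 < (-1) ^+ (m - k.+1) * p^`().[f k].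
Proof.
case=> f_inc l0 pE km; rewrite {}pE derivZ hornerZ mulrCA mulr_gt0 //.
rewrite (bigD1 (Ordinal km)) //= derivM derivXsubC mul1r hornerD hornerM.
rewrite hornerXsubC subrr mul0r addr0.
(* Moving the [k]-th zero to [f k - 1] turns the missing factor into 1, so [prod_sign] applies with
   [k.+1] zeros on the left. *)
set g := fun i => if (i == k)%N then f k - 1 else f i.
have -> : (\prod_(i < m | i != Ordinal km) ('X - (f i)%:P)).[f k]
          = \prod_(i < m) (f k - g i).
  rewrite [RHS](bigD1 (Ordinal km)) //= {1}/g eqxx opprB addrC subrK mul1r.
  rewrite horner_prod; apply: eq_bigr => i ik; rewrite hornerXsubC /g.
  by case: eqP => // e; case/eqP: ik; apply: val_inj.
apply: prod_sign => // i; rewrite /g.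
  case: eqP => [_|ik]; first by rewrite ltrBlDl ltrDr ltr01.
  by rewrite ltnS => ik'; apply: f_inc => //; lia.
by case: eqP => [|ik]; [lia|move=> ?; apply: f_inc; lia].
Qed.

Lemma simple_zerosP (R : realType) (p : {poly R}) m f :
  size p = m.+1 -> 0 < lead_coef p -> increasing_upto m f ->
  (forall i, (i < m)%N -> p.[f i] = 0) -> simple_zeros p m f.
Proof.
move=> sp l0 f_inc fp; split=> //.
rewrite -(big_mkord xpredT (fun i => 'X - (f i)%:P)) /index_iota subn0.
rewrite -(big_map f xpredT (fun y => 'X - y%:P)).
apply: all_roots_prod_XsubC; first by rewrite size_map size_iota.
  apply/allP => x; case/mapP => i; rewrite mem_iota /= => im ->.
  by apply/rootP; apply: fp.
rewrite uniq_rootsE map_inj_in_uniq ?iota_uniq // => i j.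
rewrite !mem_iota /= => im jm fij.
case: (ltngtP i j) => // ij; have := f_inc _ _ ij; rewrite fij ltxx.
  by move=> /(_ jm).
by move=> /(_ im).
Qed.

(** The signs alternate along [z], so the intermediate value theorem gives a zero in each of the [m]
    gaps, and the degree allows no more. *)
Lemma simple_zeros_between (R : realType) (p : {poly R}) m (z : nat -> R) :
  size p = m.+1 -> 0 < lead_coef p ->
  (forall i, (i < m)%N -> z i < z i.+1) ->
  (forall i, (i <= m)%N -> 0 < (-1) ^+ (m - i) * p.[z i]) ->
  exists2 f, simple_zeros p m f & forall i, (i < m)%N -> z i < f i < z i.+1.
Proof.
move=> sp l0 z_inc z_sgn.
have /choice[f fP] : forall i, exists x, (i < m)%N -> z i < x < z i.+1 /\ p.[x] = 0.
  move=> i; case: (ltnP i m) => [im|]; last by exists 0.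
  have [|x xi /rootP px] := @poly_ivtoo R p (z i) (z i.+1) (ltW (z_inc _ im)).
    have := mulr_gt0 (z_sgn _ (ltnW im)) (z_sgn _ im).
    rewrite (_ : m - i = (m - i.+1).+1)%N; last by lia.
    by rewrite exprS mulN1r !mulNr mulr_signACA oppr_gt0.
  by exists x => _; split=> //; move: xi; rewrite in_itv.
have f_step i : (i.+1 < m)%N -> f i < f i.+1.
  move=> im; have [/andP[_ +] _] := fP i (ltnW im).
  by move=> /lt_trans -> //; have [/andP[+ _]] := fP i.+1 im.
exists f; last by move=> i /fP[].
apply: simple_zerosP => //; last by move=> i /fP[].
move=> i j + jm; elim: j jm => // j IHj jm.
rewrite ltnS leq_eqVlt => /predU1P[->|ij]; first exact: f_step.
by apply: lt_trans (f_step _ jm); apply: IHj => //; apply: ltnW.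
Qed.

Lemma gt0_at_pinfty (R : realType) (p : {poly R}) (b : R) :
  0 < lead_coef p -> exists2 x, b < x & 0 < p.[x].
Proof.
move=> l0; have [x xP] := poly_pinfty_gt_lc l0.
exists (Num.max x (b + 1)); first by rewrite lt_max ltrDl ltr01 orbT.
by apply: lt_le_trans l0 (xP _ _); rewrite le_max lexx.
Qed.

Lemma sign_at_minfty (R : realType) (p : {poly R}) m (b : R) :
  size p = m.+1 -> 0 < lead_coef p -> exists2 x, x < b & 0 < (-1) ^+ m * p.[x].
Proof.
move=> sp l0; have [|x bx px] := @gt0_at_pinfty R ((-1) ^+ m *: (p \Po - 'X)) (- b).
  rewrite lead_coefZ lead_coef_comp ?size_polyN ?size_polyX // lead_coefN lead_coefX.
  by rewrite sp mulrCA -exprD addnn -signr_odd odd_double mulr1.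
exists (- x); first by rewrite ltrNl.
by move: px; rewrite hornerZ horner_comp hornerN hornerX.
Qed.

(* The signs at [x] force one zero below [x 0], hence one in each gap. *)
Lemma simple_zeros_left (R : realType) (p : {poly R}) m (x : nat -> R) :
  size p = m.+1 -> 0 < lead_coef p -> increasing_upto m x ->
  (forall i, (i < m)%N -> 0 < (-1) ^+ (m - i.+1) * p.[x i]) ->
  exists2 f, simple_zeros p m f &
    forall i, (i < m)%N -> f i < x i /\ forall j, (j < i)%N -> x j < f i.
Proof.
move=> sp l0 x_inc x_sgn; have [x0 x0P x0s] := sign_at_minfty (x 0) sp l0.
pose z i := if i is j.+1 then x j else x0.
have [||f f_zeros fz] := @simple_zeros_between _ p m z sp l0.
- by case=> [|i] im //=; apply: x_inc.
- by case=> [|i] im /=; [rewrite subn0|apply: x_sgn].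
exists f => // i im; have /andP[zi fi] := fz i im; split=> // j ji.
apply: le_lt_trans zi; case: i im ji {fi} => // i im; rewrite ltnS leq_eqVlt.
by case/predU1P=> [->|ji] //=; apply/ltW/x_inc => //; apply: ltnW.
Qed.

(** Mirror image of [simple_zeros_left]: the extra sample point is now a large [x1] at which [p] is
    positive. *)
Lemma simple_zeros_right (R : realType) (p : {poly R}) m (x : nat -> R) :
  size p = m.+1 -> 0 < lead_coef p -> increasing_upto m x ->
  (forall i, (i < m)%N -> 0 < (-1) ^+ (m - i) * p.[x i]) ->
  exists2 f, simple_zeros p m f & forall i, (i < m)%N -> x i < f i.
Proof.
move=> sp l0 x_inc x_sgn.
have [x1 x1P x1s] := gt0_at_pinfty (\big[Num.max/0]_(i < m) x i) l0.
pose z i := if (i < m)%N then x i else x1.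
have [||f f_zeros fz] := @simple_zeros_between _ p m z sp l0.
- move=> i im; rewrite /z im; case: ifP => [im1|_]; first exact: x_inc.
  exact: le_lt_trans (le_bigmax _ (fun i : 'I_m => x i) (Ordinal im)) x1P.
- move=> i im; rewrite /z; case: ltnP => [im1|im1]; first exact: x_sgn.
  by move: im1; rewrite -subn_eq0 => /eqP ->; rewrite mul1r.
by exists f => // i im; have /andP[+ _] := fz i im; rewrite /z im.
Qed.

(** Pigeonhole: if [v i < u i], the [i.+1] distinct zeros [v 0, ..., v i] would all be among the [i]
    zeros of [u] before [u i]. *)
Lemma simple_zeros_unique (R : realType) (p : {poly R}) m f g :
  simple_zeros p m f -> simple_zeros p m g ->
  forall i, (i < m)%N -> f i = g i.
Proof.
move=> pf pg.
suff H (u v : nat -> R) : simple_zeros p m u -> simple_zeros p m v ->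
    forall i, (i < m)%N -> u i <= v i.
  by move=> i im; apply: le_anti; rewrite !H.
move=> pu pv i im; rewrite leNgt; apply/negP => vu.
have root_mem : forall j, (j < m)%N -> exists2 k : 'I_m, true & v j = u k.
  move=> j jm; have := simple_zeros_root pv jm.
  rewrite (simple_zeros_horner _ pu) => /eqP; rewrite mulf_eq0.
  case: (pu) => _ /gt_eqF -> _ /= /prodf_eq0[k _]; rewrite subr_eq0 => /eqP vk.
  by exists k.
have [[u_inc _ _] [v_inc _ _]] := (pu, pv).
have ule j k : (j <= k)%N -> (k < m)%N -> u j <= u k.
  by rewrite leq_eqVlt => /predU1P[->//|jk km]; apply/ltW/u_inc.
have vle j k : (j <= k)%N -> (k < m)%N -> v j <= v k.
  by rewrite leq_eqVlt => /predU1P[->//|jk km]; apply/ltW/v_inc.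
pose F (j : 'I_i.+1) : R := v j.
have mem : forall j : 'I_i.+1, exists k : 'I_i, v j = u k.
  move=> j; have jm : (j < m)%N by apply: leq_ltn_trans im; rewrite -ltnS.
  have [k _ vk] := root_mem j jm; case: (ltnP k i) => [ki|ik].
    by exists (Ordinal ki).
  have := ule _ _ ik (ltn_ord k); rewrite -vk => /(lt_le_trans vu).
  by rewrite ltNge vle // -ltnS.
have /choice[h hP] := mem.
have h_inj : injective h.
  move=> j k hjk; have vjk : v j = v k by rewrite !hP hjk.
  apply: val_inj => /=; case: (ltngtP j k) => // jk.
    by have := v_inc _ _ jk (leq_ltn_trans (leq_ord k) im); rewrite vjk ltxx.
  by have := v_inc _ _ jk (leq_ltn_trans (leq_ord j) im); rewrite vjk ltxx.
by have := leq_card h h_inj; rewrite !card_ord ltnn.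
Qed.

(** * Recurrences of Eulerian type *)

(** For [a = 1] and [b = 0] this is the classical recurrence of the Eulerian polynomials; [q] is the
    polynomial preceding [p]. *)
Definition euler_step (R : realType) (a : R) (k : nat) (b : R) (p q : {poly R}) :
    {poly R} :=
  a *: p + k%:R *: ('X * p) + 'X * (1 - 'X) * p^`() + b *: ('X * q).

Lemma coef0_euler_step (R : realType) (a : R) k b p q :
  (euler_step a k b p q)`_0 = a * p`_0.
Proof.
by rewrite /euler_step -mulrA !(coefD, coefZ, coefXM) /= !mulr0 !addr0.
Qed.

Lemma coefS_euler_step (R : realType) (a : R) k b p q j :
  (euler_step a k b p q)`_j.+1 =
  (a + j.+1%:R) * p`_j.+1 + (k%:R - j%:R) * p`_j + b * q`_j.
Proof.
rewrite /euler_step -mulrA mulrBl mul1r !(coefD, coefN, coefZ, coefXM) /=.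
rewrite !coef_deriv; case: j => [|j] /=.
  rewrite mulr0n subr0 mulr1n.
  by move: p`_0 p`_1 q`_0 (k%:R : R) => x y z t; ring.
rewrite -[p`_j.+2 *+ _]mulr_natr -[p`_j.+1 *+ _]mulr_natr.
move: p`_j.+2 p`_j.+1 q`_j.+1 (k%:R : R) (j.+2%:R : R) (j.+1%:R : R) => x y z t u v.
ring.
Qed.

Lemma horner_euler_step (R : realType) (a : R) k b p q x :
  (euler_step a k b p q).[x] =
  (a + k%:R * x) * p.[x] + x * (1 - x) * p^`().[x] + b * x * q.[x].
Proof.
rewrite /euler_step -polyC1 !(hornerD, hornerN, hornerM, hornerZ, hornerX, hornerC).
by move: p.[x] p^`().[x] q.[x] (k%:R : R) => u v w t; ring.
Qed.

(* At a zero [x i < 0] of [p] the new polynomial has the sign of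
   [- p^`().[x i]], because [q] and [p^`()] have the same sign there. *)
Lemma euler_step_zeros (R : realType) (a b : R) m (p q : {poly R}) x :
  0 < a -> 0 <= b -> simple_zeros p m x -> (forall i, (i < m)%N -> x i < 0) ->
  0 < p.[0] -> (size q <= m.+1)%N -> 0 <= q`_m ->
  (forall i, (i < m)%N -> 0 < p^`().[x i] * q.[x i]) ->
  let p' := euler_step a m.+1 b p q in
  exists y, [/\ simple_zeros p' m.+1 y, forall i, (i < m.+1)%N -> y i < 0,
    0 < p'.[0] & forall i, (i < m.+1)%N -> 0 < p'^`().[y i] * p.[y i]].
Proof.
move=> a0 b0 px x0 p0 sq qm pq p'.
have sp := simple_zeros_size px.
have [x_inc l0 _] := px.
(* The factor [m.+1 - m = 1] keeps the leading coefficient of [p], so the degree rises by exactly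
   one. *)
have p'm : p'`_m.+1 = lead_coef p + b * q`_m.
  rewrite coefS_euler_step lead_coefE sp [p`_m.+1]nth_default ?sp //= mulr0 add0r.
  by rewrite -natrB ?subSnn ?mul1r // leqnSn.
have p'm0 : 0 < p'`_m.+1 by rewrite p'm ltr_pwDl // mulr_ge0.
have sp' : size p' = m.+2.
  apply/eqP; rewrite eqn_leq; apply/andP; split; last first.
    rewrite ltnNge; apply/negP => /leq_sizeP/(_ m.+1 (leqnn _)) e.
    by rewrite e ltxx in p'm0.
  apply/leq_sizeP => -[//|j]; rewrite ltnS => mj; rewrite coefS_euler_step.
  rewrite [p`_j.+1]nth_default ?sp 1?leqW // [p`_j]nth_default ?sp //.
  by rewrite [q`_j]nth_default ?(leq_trans sq) // !mulr0 !addr0.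
have l'0 : 0 < lead_coef p' by rewrite lead_coefE sp'.
have p'0 : 0 < p'.[0] by rewrite horner_coef0 coef0_euler_step -horner_coef0 mulr_gt0.
(* The sample points are the zeros of [p] followed by 0, where [p'] is positive. *)
pose z i := if (i < m)%N then x i else 0.
have z_inc : increasing_upto m.+1 z.
  move=> i j ij jm; rewrite /z (leq_trans ij) //.
  case: ifP => jm'; last by apply: x0; apply: leq_trans ij _.
  exact: x_inc.
have [|y y_zeros yz] := simple_zeros_left sp' l'0 z_inc.
  move=> i im; rewrite /z; case: ltnP => [im'|mi]; last first.
    by rewrite (_ : m.+1 - i.+1 = 0)%N ?mul1r //; lia.
  have -> : p'.[x i] = x i * ((1 - x i) * p^`().[x i] + b * q.[x i]).
    rewrite horner_euler_step (simple_zeros_root px im'); ring.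
  have ps := simple_zeros_deriv_sign px im'.
  rewrite (_ : (m.+1 - i.+1 = (m - i.+1).+1)%N); last by lia.
  rewrite exprS mulN1r mulNr mulrCA -mulNr mulr_gt0 ?oppr_gt0 ?x0 //.
  rewrite mulrDr ltr_pwDl //.
    by rewrite mulrCA mulr_gt0 // subr_gt0 (lt_trans (x0 _ im')).
  by rewrite mulrCA mulr_ge0 // -(pmulr_rge0 _ ps) mulr_signACA ltW // pq.
exists y; split=> //.
  move=> i im; have [+ _] := yz i im; move=> /lt_le_trans; apply.
  by rewrite /z; case: ifP => // im'; apply/ltW/x0.
move=> i im; have s1 := simple_zeros_deriv_sign y_zeros im.
have [yi yj] := yz i im.
(* The zeros of [p] separate those of [p'], so at each [y i] the sign of [p] is that of the
   derivative of [p']. *)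
have : 0 < (-1) ^+ (m - i) * p.[y i].
  apply: (simple_zeros_sign px) => //.
    by move=> j ji; have := yj j ji; rewrite /z (leq_trans ji).
  move=> j /andP[ij jm]; apply: lt_le_trans yi _.
  rewrite /z (leq_ltn_trans ij jm).
  by move: ij; rewrite leq_eqVlt => /predU1P[->//|ij]; apply/ltW/x_inc.
by move/(mulr_gt0 s1); rewrite subSS mulr_signACA.
Qed.

(** Induction with [euler_step_zeros]. The claim is strengthened by the degree bound and the top
    coefficient of [f m], which the next step needs. *)
Lemma euler_rec_zeros (R : realType) (a : R) (b : nat -> R)
    (f : nat -> {poly R}) (c0 c1 : R) :
  0 < a -> (forall k, 0 <= b k) -> f 0 = c0%:P -> f 1 = c1%:P -> 0 <= c0 ->
  0 < c1 ->
  (forall m, f m.+2 = euler_step a m.+1 (b m) (f m.+1) (f m)) ->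
  forall m, exists y, [/\ simple_zeros (f m.+1) m y,
    forall i, (i < m)%N -> y i < 0, 0 < (f m.+1).[0]
    & forall i, (i < m)%N -> 0 < (f m.+1)^`().[y i] * (f m).[y i]].
Proof.
move=> a0 b0 f0 f1 c00 c10 fS.
suff H m : exists y, [/\ simple_zeros (f m.+1) m y,
    forall i, (i < m)%N -> y i < 0, 0 < (f m.+1).[0]
    & forall i, (i < m)%N -> 0 < (f m.+1)^`().[y i] * (f m).[y i]] /\
    (size (f m) <= m.+1)%N /\ 0 <= (f m)`_m.
  by move=> m; have [y []] := H m; exists y.
elim: m => [|m [x [[fx x0 fm0 fxm] [sf fm]]]].
  exists (fun=> 0); rewrite f0 f1 coefC /= size_polyC hornerC; split.
    split=> //; apply: simple_zerosP => //; last by rewrite lead_coefC.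
    by rewrite size_polyC gt_eqF.
  by split=> //; case: (c0 != 0).
have [y [y1 y2 y3 y4]] := euler_step_zeros a0 (b0 m) fx x0 fm0 sf fm fxm.
exists y; rewrite fS; split=> //; rewrite (simple_zeros_size fx).
by split=> //; rewrite nth_default ?(simple_zeros_size fx).
Qed.

(** * Permutations by fixed points and excedances *)

(** Deleting the arc from [i] to [j] inverts [lift_perm i j]. *)
Lemma sum_lift_perm (V : nmodType) n (i j : 'I_n.+1) (F : 'S_n.+1 -> V) :
  \sum_(s : 'S_n.+1 | s i == j) F s = \sum_(t : 'S_n) F (lift_perm i j t).
Proof.
have lift_inj : injective (lift_perm i j : 'S_n -> 'S_n.+1).
  move=> t u /permP tu; apply/permP => k.
  by apply: (@lift_inj _ j); rewrite -!(lift_perm_lift i) tu.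
have lift_im (s : 'S_n.+1) : s i = j -> exists t, s = lift_perm i j t.
  move=> sij.
  have /choice[g gE] : forall k, exists l, s (lift i k) = lift j l.
    move=> k; case: (unliftP j (s (lift i k))) => [l ->|]; first by exists l.
    by rewrite -sij => /perm_inj/eqP; rewrite eq_sym (negPf (neq_lift _ _)).
  have g_inj : injective g.
    move=> k l gkl; apply: (@fintype.lift_inj _ i); apply: (@perm_inj _ s).
    by rewrite !gE gkl.
  exists (perm g_inj); apply/permP => k.
  by case: (unliftP i k) => [l|] ->; rewrite ?lift_perm_lift ?lift_perm_id ?permE ?gE.
pose h (s : 'S_n.+1) : 'S_n := odflt 1%g [pick t | s == lift_perm i j t].
rewrite (reindex (lift_perm i j : 'S_n -> 'S_n.+1)).
  by apply: eq_bigl => t; rewrite lift_perm_id eqxx.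
exists h => [t _|s].
  rewrite /h; case: pickP => [u /eqP/lift_inj->//|/(_ t)].
  by rewrite eqxx.
rewrite inE => /eqP/lift_im[t ->]; rewrite /h; case: pickP => [u /eqP->//|/(_ t)].
by rewrite eqxx.
Qed.

Definition step_weight (A : Type) (s x y : A) (n : nat) (k j : 'I_n) : A :=
  if j == k then s else if (k < j)%N then x else y.

(* The generating polynomial of fixed points, excedances and anti-excedances,
   evaluated at [s], [x] and [y]. *)
Definition perm_sum (A : comNzRingType) (n : nat) (s x y : A) : A :=
  \sum_(t : 'S_n) \prod_(k < n) step_weight s x y k (t k).

Lemma step_weight_lift (A : Type) (s x y : A) n (i : 'I_n.+1) (k j : 'I_n) :
  step_weight s x y (lift i k) (lift i j) = step_weight s x y k j.
Proof.
rewrite /step_weight (inj_eq lift_inj).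
suff -> : (lift i k < lift i j)%N = (k < j)%N by [].
by rewrite /= /bump; lia.
Qed.

Lemma prod_lift (A : comNzRingType) n (i : 'I_n.+1) (F : 'I_n.+1 -> A) :
  \prod_(k < n.+1 | k != i) F k = \prod_(k < n) F (lift i k).
Proof.
rewrite big_mkcond (bigD1_ord i) //= eqxx mul1r.
by apply: eq_bigr => k _; rewrite eq_sym neq_lift.
Qed.

(** Mark the fixed point first, in [n.+1] ways; deleting it leaves an arbitrary permutation of [n]
    points and changes no other weight. *)
Lemma perm_sum_marked (A : comNzRingType) n (s x y : A) :
  \sum_(t : 'S_n.+1) \sum_(i < n.+1 | t i == i)
    \prod_(k < n.+1 | k != i) step_weight s x y k (t k)
  = n.+1%:R * perm_sum n s x y.
Proof.
rewrite (exchange_big_dep xpredT) //=.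
rewrite mulr_natl -[n.+1 in RHS]card_ord -sumr_const; apply: eq_bigr => i _.
rewrite sum_lift_perm; apply: eq_bigr => t _; rewrite prod_lift.
by apply: eq_bigr => k _; rewrite lift_perm_lift step_weight_lift.
Qed.

(* A permutation of [n.+1] points arises by inserting the largest point either
   as a new fixed point or into the arc leaving some point [i], which is
   replaced by an excedance followed by an anti-excedance. *)
Lemma perm_sum_recS (A : comNzRingType) n (s x y : A) :
  perm_sum n.+1 s x y = s * perm_sum n s x y +
    x * y * \sum_(t : 'S_n) \sum_(i < n)
      \prod_(k < n | k != i) step_weight s x y k (t k).
Proof.
pose M : 'I_n.+1 := ord_max.
rewrite /perm_sum (partition_big (fun t : 'S_n.+1 => (t^-1)%g M) xpredT) //=.
(* A permutation sending [j] to [M] is [tperm j M] followed by one that fixes [M]; [j = M] is the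
   case of a new fixed point. *)
have -> : \sum_(j < n.+1) \sum_(t : 'S_n.+1 | (t^-1)%g M == j)
    \prod_(k < n.+1) step_weight s x y k (t k) =
  \sum_(j < n.+1) \sum_(u : 'S_n)
    \prod_(k < n.+1) step_weight s x y k ((tperm j M * lift_perm M M u)%g k).
  apply: eq_bigr => j _.
  rewrite -(sum_lift_perm M M (fun u =>
    \prod_k step_weight s x y k ((tperm j M * u)%g k))).
  rewrite [LHS](reindex_inj (mulgI (tperm j M))) /=; apply: eq_bigl => t.
  by rewrite invMg permM tpermV (canF_eq (tpermK j M)) tpermL (canF_eq (permKV t)) eq_sym.
have liftM (k : 'I_n) : lift M k = k :> nat by rewrite /= /bump leqNgt ltn_ord.
rewrite (bigD1_ord M) //=; congr (_ + _).
  rewrite big_distrr /=; apply: eq_bigr => u _.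
  rewrite tperm1 mul1g (bigD1_ord M) //= lift_perm_id /step_weight eqxx; congr (_ * _).
  apply: eq_bigr => k _; rewrite lift_perm_lift.
  exact: (step_weight_lift s x y M k (u k)).
rewrite exchange_big /= big_distrr /=; apply: eq_bigr => u _.
rewrite big_distrr /=; apply: eq_bigr => i _.
rewrite (bigD1_ord M) //= permM tpermR lift_perm_lift.
rewrite (bigD1 i) //= permM tpermL lift_perm_id mulrA; congr (_ * _).
  rewrite /step_weight (negPf (neq_lift _ _)) eq_sym (negPf (neq_lift _ _)).
  by rewrite !liftM /= ltn_ord ltnNge ltnW // mulrC.
apply: eq_bigr => k ki; rewrite permM tpermD ?lift_perm_lift ?step_weight_lift //.
  by rewrite (inj_eq lift_inj) eq_sym.
by rewrite neq_lift.
Qed.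

(** Inversion of permutations swaps excedances and anti-excedances and keeps the fixed points. *)
Lemma perm_sumC (A : comNzRingType) n (s x y : A) :
  perm_sum n s x y = perm_sum n s y x.
Proof.
rewrite /perm_sum (reindex_inj invg_inj); apply: eq_bigr => t _.
rewrite (reindex_inj (@perm_inj _ t)); apply: eq_bigr => k _.
rewrite permK /step_weight eq_sym -val_eqE.
by case: (ltngtP (t k) k).
Qed.

Lemma perm_sumM (A : comNzRingType) n (a s x y : A) :
  perm_sum n (a * s) (a * x) (a * y) = a ^+ n * perm_sum n s x y.
Proof.
rewrite /perm_sum big_distrr /=; apply: eq_bigr => t _.
rewrite -[n in a ^+ n]card_ord -prodr_const -big_split; apply: eq_bigr => k _ /=.
by rewrite /step_weight; case: ifP => // _; case: ifP.
Qed.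

Lemma rmorph_perm_sum (A B : comNzRingType) (f : {rmorphism A -> B}) n (s x y : A) :
  f (perm_sum n s x y) = perm_sum n (f s) (f x) (f y).
Proof.
rewrite /perm_sum rmorph_sum; apply: eq_bigr => t _; rewrite rmorph_prod.
by apply: eq_bigr => k _; rewrite /step_weight; case: ifP => // _; case: ifP.
Qed.

Lemma deriv_prod (A : comNzRingType) (I : finType) (F : I -> {poly A}) :
  (\prod_i F i)^`() = \sum_i (F i)^`() * \prod_(j | j != i) F j.
Proof.
suff H (r : seq I) : uniq r -> (\prod_(i <- r) F i)^`() =
    \sum_(i <- r) (F i)^`() * \prod_(j <- r | j != i) F j.
  exact/H/index_enum_uniq.
elim: r => [|a r IHr] /=; first by rewrite !big_nil derivC.
case/andP=> ar ur; rewrite !big_cons eqxx derivM (IHr ur) /=; congr (_ * _ + _).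
  rewrite [RHS]big_seq_cond [LHS]big_seq_cond; apply: eq_bigl => i.
  by case: eqP => [->|]; rewrite ?(negPf ar) // andbT.
rewrite big_distrr /= big_seq [RHS]big_seq; apply: eq_bigr => i ir.
rewrite big_cons; case: eqP => [ai|_]; first by rewrite ai ir in ar.
by rewrite mulrCA.
Qed.

Lemma deriv_perm_sum (A : comNzRingType) n (s x y : {poly A}) :
  (perm_sum n s x y)^`() = \sum_(t : 'S_n) \sum_(i < n)
    step_weight s^`() x^`() y^`() i (t i) *
    \prod_(k < n | k != i) step_weight s x y k (t k).
Proof.
rewrite /perm_sum raddf_sum /=; apply: eq_bigr => t _; rewrite deriv_prod.
apply: eq_bigr => i _; congr (_ * _).
by rewrite /step_weight; case: ifP => // _; case: ifP.
Qed.

Lemma perm_sum0 (A : comNzRingType) (s x y : A) : perm_sum 0 s x y = 1.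
Proof.
rewrite /perm_sum (eq_bigr (fun=> 1)) => [|t _]; last by rewrite big_ord0.
by rewrite sumr_const card_Sn.
Qed.

Definition fix_exc_poly (R : realType) (n : nat) (c : R) : {poly R} :=
  perm_sum n c%:P 'X 1.

(** The sum in [perm_sum_recS] omits the weight [w] of one arc. Each arc satisfies [1 = (1 - x) w' +
    w + (1 - c) [fixed]]; summed over the arcs, the three terms give the derivative, [n.+1] copies
    of the polynomial, and the marked fixed points of [perm_sum_marked]. *)
Lemma fix_exc_poly_rec (R : realType) n (c : R) :
  fix_exc_poly n.+2 c = euler_step c n.+1 ((1 - c) * n.+1%:R)
    (fix_exc_poly n.+1 c) (fix_exc_poly n c).
Proof.
rewrite /fix_exc_poly perm_sum_recS.
set P := perm_sum n.+1 _ _ _; set S := \sum_t _.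
have -> : S = (1 - 'X) * P^`() + n.+1%:R * P
    + (1 - c%:P) * (n.+1%:R * perm_sum n c%:P 'X 1).
  rewrite -perm_sum_marked deriv_perm_sum /S !big_distrr /= -!big_split /=.
  apply: eq_bigr => t _; rewrite !big_distrr /= [X in _ = _ + _ + X]big_mkcond /=.
  set w := \prod_(k < n.+1) _; have -> : n.+1%:R * w = \sum_(i < n.+1) w.
    by rewrite sumr_const card_ord mulr_natl.
  rewrite -!big_split /=; apply: eq_bigr => i _.
  rewrite {}/w [X in _ = _ + X + _](bigD1 i) //=.
  set Q := (LHS); rewrite -/Q -[X in _ = _ + _ * X + _]/Q.
  have d1 : (1 : {poly R})^`() = 0 := derivC 1.
  by rewrite /step_weight derivC derivX d1; case: eqP => _; last case: ifP => _; ring.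
rewrite /euler_step -!mul_polyC polyCM polyCB !polyC_natr; ring.
Qed.

Lemma fix_exc_poly0 (R : realType) (c : R) : fix_exc_poly 0 c = 1%:P.
Proof. exact: perm_sum0. Qed.

Lemma fix_exc_poly1 (R : realType) (c : R) : fix_exc_poly 1 c = c%:P.
Proof.
rewrite /fix_exc_poly perm_sum_recS [\sum_t _]big1 => [|t _]; last by rewrite big_ord0.
by rewrite perm_sum0 mulr0 addr0 mulr1.
Qed.

Lemma horner_fix_exc_poly (R : realType) (n : nat) (c x : R) :
  (fix_exc_poly n c).[x] = perm_sum n c x 1.
Proof.
rewrite -[LHS]/(horner_eval x _) rmorph_perm_sum /= /horner_eval.
by rewrite hornerC hornerX hornerC.
Qed.

(** For fixed [x] the weight of a fixed point becomes the indeterminate; differentiating in it marks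
    a fixed point. *)
Lemma fix_exc_poly_param (R : realType) (x : R) :
  exists g : nat -> {poly R}, (forall n (c : R), (g n).[c] = (fix_exc_poly n c).[x]) /\
    forall n, (g n.+1)^`() = n.+1%:R * g n.
Proof.
exists (fun n => perm_sum n 'X x%:P 1); split=> [k c|k].
  rewrite horner_fix_exc_poly -[LHS]/(horner_eval c _) rmorph_perm_sum /=.
  by rewrite /horner_eval !hornerC hornerX.
rewrite deriv_perm_sum -perm_sum_marked; apply: eq_bigr => t _.
rewrite [RHS]big_mkcond; apply: eq_bigr => i _; rewrite /step_weight derivX !derivC.
by case: ifP => _; rewrite ?mul1r // if_same mul0r.
Qed.

(** * Motion of the zeros with the weight of a fixed point *)

Lemma fix_exc_zeros_gt0 (R : realType) (c : R) : 0 < c -> c <= 1 ->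
  forall m, exists y, [/\ simple_zeros (fix_exc_poly m.+1 c) m y,
    forall i, (i < m)%N -> y i < 0, 0 < (fix_exc_poly m.+1 c).[0]
    & forall i, (i < m)%N ->
      0 < (fix_exc_poly m.+1 c)^`().[y i] * (fix_exc_poly m c).[y i]].
Proof.
move=> c0 c1 m.
apply: (@euler_rec_zeros R c (fun k => (1 - c) * k.+1%:R)
  (fun n => fix_exc_poly n c) 1 c) => //.
- by move=> k; rewrite mulr_ge0 // subr_ge0.
- exact: fix_exc_poly0.
- exact: fix_exc_poly1.
- by move=> k; apply: fix_exc_poly_rec.
Qed.

(* The derangement polynomials are ['X * g] where [g] satisfies a recurrence of
   the same shape with positive constant coefficients. *)
Lemma fix_exc_zeros_eq0 (R : realType) m :
  exists y, [/\ simple_zeros (fix_exc_poly m.+2 (0 : R)) m.+1 y,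
    y m = 0, forall i, (i < m)%N -> y i < 0 & forall i, (i < m)%N ->
    0 < (fix_exc_poly m.+2 0)^`().[y i] * (fix_exc_poly m.+1 0).[y i]].
Proof.
pose P n := fix_exc_poly n (0 : R).
pose g n := drop_poly 1 (P n.+1).
have gP n : P n.+1 = 'X * g n.
  apply/polyP => -[|i]; rewrite coefXM coef_drop_poly ?addn1 //=.
  case: n => [|n]; first by rewrite /P fix_exc_poly1 coef0.
  by rewrite /P fix_exc_poly_rec coef0_euler_step mul0r.
have X0 : ('X : {poly R}) != 0 by rewrite polyX_eq0.
have g0 : g 0 = 0%:P by apply: (mulfI X0); rewrite -gP /P fix_exc_poly1 mulr0.
(* The product rule adds [(1 - 'X) * g n.+1], which turns the coefficients 0 and [n.+2] into 1 and
   [n.+1]. *)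
have gS n : g n.+2 = euler_step 1 n.+1 n.+2%:R (g n.+1) (g n).
  apply: (mulfI X0); rewrite -gP /P fix_exc_poly_rec -/(P _) -/(P n.+1) !gP.
  rewrite /euler_step derivM derivX subr0 mul1r -!mul_polyC !polyC_natr.
  rewrite -[n.+2]addn1 natrD; ring.
have g1 : g 1 = 1%:P.
  apply: (mulfI X0); rewrite -gP /P fix_exc_poly_rec fix_exc_poly0 fix_exc_poly1.
  by rewrite /euler_step derivC -!mul_polyC !polyC0 subr0 mulr1 polyC1; ring.
have [y [gy y0 gm0 gym]] := @euler_rec_zeros R 1 (fun k => k.+2%:R) g 0 1
  ltr01 (fun k => ler0n _ _) g0 g1 (lexx 0) ltr01 gS m.
have [y_inc l0 _] := gy; have sg := simple_zeros_size gy.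
exists (fun i => if (i < m)%N then y i else 0); rewrite ltnn; split=> //.
- apply: simple_zerosP; rewrite -?/(P m.+2) ?gP.
  + by rewrite mulrC size_mulX ?sg // -size_poly_gt0 sg.
  + by rewrite mulrC lead_coefMX.
  + move=> i j ij jm; rewrite (leq_trans ij jm); case: ifP => jm'; first exact: y_inc.
    by apply: y0; apply: leq_trans ij _.
  move=> i im; rewrite hornerM hornerX; case: ifP => im'; last by rewrite mul0r.
  by rewrite (simple_zeros_root gy) // mulr0.
- by move=> i im; rewrite im; apply: y0.
move=> i im; rewrite im -!/(P _) !gP derivM derivX mul1r !(hornerD, hornerM, hornerX).
rewrite (simple_zeros_root gy) // add0r mulrACA mulr_gt0 ?gym //.
by rewrite nmulr_lgt0 y0.
Qed.

(** Both cases in one form: only for [c = 0] does the last zero reach 0, and there the sign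
    condition is not claimed. *)
Lemma fix_exc_zeros (R : realType) m (c : R) : 0 <= c <= 1 ->
  exists y, [/\ simple_zeros (fix_exc_poly m.+2 c) m.+1 y,
    forall i, (i < m.+1)%N -> y i < 0 \/ [/\ c = 0, i = m & y i = 0]
    & forall i, (i < m.+1)%N -> y i < 0 ->
    0 < (fix_exc_poly m.+2 c)^`().[y i] * (fix_exc_poly m.+1 c).[y i]].
Proof.
case/andP; rewrite le_eqVlt => /predU1P[<- _|c0 c1].
  have [y [y1 ym y0 y2]] := fix_exc_zeros_eq0 R m; exists y; split=> //.
    by move=> i; rewrite ltnS leq_eqVlt => /predU1P[->|/y0]; [right|left].
  move=> i; rewrite ltnS leq_eqVlt => /predU1P[->|im _]; first by rewrite ym ltxx.
  exact: y2.
have [y [y1 y0 _ y2]] := fix_exc_zeros_gt0 c0 c1 m.+1.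
by exists y; split=> // i im; [left; apply: y0|move=> _; apply: y2].
Qed.

Lemma uniform_eps (R : realType) (Q : nat -> R -> Prop) m :
  (forall i e e', e' <= e -> Q i e -> Q i e') ->
  (forall i, (i < m)%N -> exists2 e, 0 < e & Q i e) ->
  exists2 e, 0 < e & forall i, (i < m)%N -> Q i e.
Proof.
move=> Qle; elim: m => [|m IHm] mQ; first by exists 1.
have [e e0 eQ] := IHm (fun i im => mQ i (ltnW im)); have [d d0 dQ] := mQ m (ltnSn m).
exists (Num.min e d); first by rewrite lt_min e0.
move=> i; rewrite ltnS leq_eqVlt => /predU1P[->|im].
  by apply: Qle dQ; rewrite ge_min lexx orbT.
by apply: Qle (eQ i im); rewrite ge_min lexx.
Qed.

(** With the root factored out, the cofactor keeps its sign near [a]. The multiplier [w] lets one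
    statement serve both signs of the derivative. *)
Lemma sign_near_simple_root (R : realType) (g : {poly R}) (a w : R) :
  g.[a] = 0 -> 0 < w * g^`().[a] -> exists2 e, 0 < e & forall c,
    (a < c < a + e -> 0 < w * g.[c]) /\ (a - e < c < a -> 0 < - w * g.[c]).
Proof.
move=> /rootP/factor_theorem[h gE] wg.
have wh : 0 < w * h.[a].
  by move: wg; rewrite gE derivM derivXsubC hornerD !hornerM hornerXsubC subrr
    mulr0 add0r hornerC mulr1.
have [e e0 eP] := @poly_cont R a (w *: h) _ wh.
have {}eP c : `|c - a| < e -> 0 < w * h.[c].
  move=> /eP; rewrite !hornerZ ltr_norml => /andP[+ _].
  by rewrite ltrBrDr addNr.
exists e => // c; split=> /andP[ac ca]; rewrite gE hornerM hornerXsubC mulrA.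
  by rewrite mulr_gt0 ?subr_gt0 // eP // gtr0_norm ?subr_gt0 // ltrBlDl.
rewrite mulNr mulNr -mulrN opprB mulr_gt0 ?subr_gt0 // eP //.
by rewrite ltr0_norm ?subr_lt0 // opprB ltrBlDl -ltrBlDr.
Qed.

(** The derivative in [c] at fixed [x] is a positive multiple of the previous polynomial, whose sign
    decides how the value at [x] crosses 0. *)
Lemma fix_exc_local_sign (R : realType) m (c0 x w : R) :
  (fix_exc_poly m.+2 c0).[x] = 0 -> 0 < w * (fix_exc_poly m.+1 c0).[x] ->
  exists2 e, 0 < e & forall c,
    (c0 < c < c0 + e -> 0 < w * (fix_exc_poly m.+2 c).[x]) /\
    (c0 - e < c < c0 -> 0 < - w * (fix_exc_poly m.+2 c).[x]).
Proof.
have [g [gE g']] := fix_exc_poly_param x.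
move=> x0 wx; have [||e e0 eP] := @sign_near_simple_root _ (g m.+2) c0 w.
- by rewrite gE.
- by rewrite g' -polyC_natr hornerCM gE mulrCA mulr_gt0 ?ltr0n.
by exists e => // c; rewrite -!gE.
Qed.

(** Just above [c0] the polynomial has at each old zero the sign that its derivative in [x] had
    there at [c0], the pattern required by [simple_zeros_left]. *)
Lemma fix_exc_zeros_right (R : realType) m (c0 : R) z : 0 <= c0 <= 1 ->
  simple_zeros (fix_exc_poly m.+2 c0) m.+1 z ->
  exists2 e, 0 < e & forall c y, c0 < c < c0 + e -> c <= 1 ->
    simple_zeros (fix_exc_poly m.+2 c) m.+1 y -> forall i, (i < m.+1)%N -> y i < z i.
Proof.
move=> c001 cz; have [z' [cz' z'0 z'P]] := fix_exc_zeros m c001.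
have zz' := simple_zeros_unique cz cz'; have [z_inc _ _] := cz.
have [||e e0 eP] := @uniform_eps R (fun i e => forall c, c0 < c < c0 + e -> c <= 1 ->
   0 < (-1) ^+ (m.+1 - i.+1) * (fix_exc_poly m.+2 c).[z i]) m.+1.
- move=> i e e' ee' H c /andP[cc ce]; apply: H; rewrite cc /=.
  by apply: lt_le_trans ce _; rewrite lerD2l.
- move=> i im; rewrite zz' //; case: (z'0 i im) => [zi|[c00 -> zm]].
    have [||e e0 eP] := @fix_exc_local_sign R m c0 (z' i) ((-1) ^+ (m.+1 - i.+1)).
    + exact: simple_zeros_root cz' im.
    + have s := simple_zeros_deriv_sign cz' im.
      rewrite -(pmulr_rgt0 _ s) mulr_signACA.
      exact: z'P.
    by exists e => // c cc _; have [+ _] := eP c; apply.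
  (* At [c0 = 0] the last zero is 0, where the value is positive for every [c] in [(0, 1]]. *)
  exists 1 => // c /andP[cc _] c1; rewrite subnn mul1r zm.
  by rewrite c00 in cc; have [? [_ _ +]] := fix_exc_zeros_gt0 cc c1 m.+1.
exists e => // c y /andP[cc ce] c1 cy i im; have [_ ly _] := cy.
have [|u cu uz] := simple_zeros_left (simple_zeros_size cy) ly z_inc.
  by move=> j jm; apply: eP => //; rewrite cc.
by rewrite (simple_zeros_unique cy cu im); have [] := uz i im.
Qed.

(** Just below [c0] the signs at the old zeros are the opposite ones, the pattern required by
    [simple_zeros_right]. *)
Lemma fix_exc_zeros_left (R : realType) m (c0 : R) z : 0 < c0 <= 1 ->
  simple_zeros (fix_exc_poly m.+2 c0) m.+1 z ->
  exists2 e, 0 < e & forall c y, c0 - e < c < c0 ->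
    simple_zeros (fix_exc_poly m.+2 c) m.+1 y -> forall i, (i < m.+1)%N -> z i < y i.
Proof.
case/andP=> c00 c01 cz; have [z' [cz' z'0 _ z'P]] := fix_exc_zeros_gt0 c00 c01 m.+1.
have zz' := simple_zeros_unique cz cz'; have [z_inc _ _] := cz.
have [||e e0 eP] := @uniform_eps R (fun i e => forall c, c0 - e < c < c0 ->
   0 < (-1) ^+ (m.+1 - i) * (fix_exc_poly m.+2 c).[z i]) m.+1.
- move=> i e e' ee' H c /andP[cc ce]; apply: H; rewrite ce andbT.
  by apply: le_lt_trans cc; rewrite lerB.
- move=> i im; rewrite zz' //.
  have [||e e0 eP] := @fix_exc_local_sign R m c0 (z' i) ((-1) ^+ (m.+1 - i.+1)).
  + exact: simple_zeros_root cz' im.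
  + have s := simple_zeros_deriv_sign cz' im.
    rewrite -(pmulr_rgt0 _ s) mulr_signACA.
    exact: z'P.
  exists e => // c cc; have [_ +] := eP c; rewrite (_ : m.+1 - i = (m.+1 - i.+1).+1)%N.
    by rewrite exprS mulN1r; apply.
  by lia.
exists e => // c y cc cy i im; have [_ ly _] := cy.
have [|u cu uz] := simple_zeros_right (simple_zeros_size cy) ly z_inc.
  by move=> j jm; apply: eP.
by rewrite (simple_zeros_unique cy cu im) uz.
Qed.

(** A supremum argument on the set [S] of parameters whose zeros lie weakly to the left of [z1]:
    [fix_exc_zeros_left] puts the supremum into [S], and [fix_exc_zeros_right] shows that it is not
    below [c2]. *)
Lemma fix_exc_zeros_antitone (R : realType) m (c1 c2 : R) z1 z2 :
  0 <= c1 -> c1 <= c2 -> c2 <= 1 ->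
  simple_zeros (fix_exc_poly m.+2 c1) m.+1 z1 ->
  simple_zeros (fix_exc_poly m.+2 c2) m.+1 z2 ->
  forall i, (i < m.+1)%N -> z2 i <= z1 i.
Proof.
move=> c10 c12 c21 cz1 cz2.
have /choice[Z ZP] : forall c : R, exists z, 0 <= c <= 1 ->
    simple_zeros (fix_exc_poly m.+2 c) m.+1 z.
  move=> c; case: (boolP (0 <= c <= 1)) => [/(fix_exc_zeros m)[z []]|_].
    by exists z.
  by exists (fun=> 0).
pose S := [set c : R | c1 <= c <= c2 /\ forall i, (i < m.+1)%N -> Z c i <= z1 i]%classic.
have S1 : S c1.
  split; first by rewrite lexx.
  by move=> i im; rewrite (simple_zeros_unique (ZP c1 _) cz1) // c10 (le_trans c12).
have S_sup : has_sup S.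
  by split; [exists c1|exists c2 => c [/andP[]]].
set s := sup S; have s1 : c1 <= s by apply: ub_le_sup => //; case: S_sup.
have s2 : s <= c2 by apply: ge_sup => [|c [/andP[]]//]; exists c1.
have s01 : 0 <= s <= 1 by rewrite (le_trans c10) // (le_trans s2).
have Ss : S s.
  split; first by rewrite s1.
  move: s1; rewrite le_eqVlt => /predU1P[<-|s1]; first by case: S1.
  have s01' : 0 < s <= 1 by rewrite (le_lt_trans c10) // (le_trans s2).
  have [e e0 eP] := fix_exc_zeros_left s01' (ZP s s01).
  have [c Sc sc] := sup_adherent e0 S_sup.
  have cs : c <= s by apply: ub_le_sup => //; case: S_sup.
  move: cs; rewrite le_eqVlt => /predU1P[<-|cs]; first by case: Sc.
  case: Sc => /andP[c1c cc2] cz i im.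
  apply: le_trans (cz i im); apply/ltW/(eP c) => //; first by rewrite sc.
  by apply: ZP; rewrite (le_trans c10) // (le_trans cc2).
suff sc2 : s = c2.
  move=> i im; case: Ss => _ /(_ i im); rewrite sc2.
  rewrite -(simple_zeros_unique (ZP c2 _) cz2) //.
  by rewrite (le_trans c10) // c21.
apply/eqP; rewrite eq_le s2 leNgt; apply/negP => sc2.
have [e e0 eP] := fix_exc_zeros_right s01 (ZP s s01).
pose c := Num.min c2 (s + e / 2).
have sc : s < c by rewrite lt_min sc2 ltrDl divr_gt0.
have cc2 : c <= c2 by rewrite ge_min lexx.
suff : c <= s by rewrite leNgt sc.
apply: ub_le_sup; first by case: S_sup.
split; first by rewrite (le_trans s1) ?cc2 // ltW.
have c01 : c <= 1 by apply: le_trans cc2 _.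
move=> i im; case: Ss => _ /(_ i im); apply: le_trans; apply/ltW/(eP c) => //.
  rewrite sc gt_min ltrD2l ltr_pdivrMr // ltr_pMr // ltr1n; apply/orP; right.
  by [].
by apply: ZP; rewrite c01 (le_trans c10) // (le_trans s1) // ltW.
Qed.

(** * Coefficients and reversal *)

Lemma size_fix_exc_poly (R : realType) n (c : R) :
  0 <= c <= 1 -> (size (fix_exc_poly n.+1 c) <= n.+1)%N.
Proof.
case: n => [|n] c01; first by rewrite fix_exc_poly1 size_polyC; case: (c != 0).
by have [y [/simple_zeros_size-> _ _]] := fix_exc_zeros n c01.
Qed.

(* Stated so that [reversal n p] is alternatingly increasing. *)
Definition alternating_coefs (R : realType) (n : nat) (p : {poly R}) : Prop :=
  [/\ forall k, 0 <= p`_k,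
    forall k l, (k <= l)%N -> (k + l = n)%N -> p`_l <= p`_k
    & forall k l, (k <= l)%N -> (k + l).+1 = n -> p`_k <= p`_l].

(** For positive indices the difference of the two coefficients to compare is exactly the sum of the
    nonnegative terms [t1] to [t4]. *)
Lemma alternating_coefs_step (R : realType) n (c : R) (p q : {poly R}) :
  0 <= c <= 1 -> (size p <= n.+1)%N -> (size q <= n.+1)%N ->
  alternating_coefs n.+1 p -> alternating_coefs n q ->
  alternating_coefs n.+2 (euler_step c n.+1 ((1 - c) * n.+1%:R) p q).
Proof.
case/andP=> c0 c1 sp sq [p0 pI pII] [q0 qI qII].
set b := (1 - c) * _; set p' := euler_step _ _ _ _ _.
have b0 : 0 <= b by rewrite mulr_ge0 // subr_ge0.
have p'0 : p'`_0 = c * p`_0 by apply: coef0_euler_step.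
(* On complementary indices the factor [n.+1 - j] is [k], so the multipliers on the two sides can be
   paired. *)
have p'S j k : (j + k = n.+1)%N ->
    p'`_j.+1 = (c + j.+1%:R) * p`_j.+1 + k%:R * p`_j + b * q`_j.
  by move=> jk; rewrite /p' coefS_euler_step -jk natrD [j%:R + _]addrC addrK.
have p'big j : (n.+1 < j)%N -> p'`_j = 0.
  case: j => // j; rewrite ltnS => nj; rewrite /p' coefS_euler_step.
  by rewrite !nth_default ?mulr0 ?addr0 ?(leq_trans sq) ?(leq_trans sp) // ltnW.
split=> [[|j]|k l|k l]; rewrite 1?leq_eqVlt.
- by rewrite p'0 mulr_ge0.
- case: (leqP j n.+1) => [jn|jn]; last by rewrite p'big // ltnW.
  rewrite (p'S j (n.+1 - j)%N) ?subnKC //.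
  by apply: addr_ge0; [apply: addr_ge0|]; apply: mulr_ge0 => //; apply: addr_ge0.
- case/predU1P=> [->//|]; case: k => [|k].
    by move=> _; rewrite add0n => ->; rewrite p'big // p'0 mulr_ge0.
  case: l => // l; rewrite ltnS => kl; rewrite addSn addnS => -[kln].
  rewrite (p'S k l.+1) ?(p'S l k.+1); try lia.
  have h1 : p`_l <= p`_k.+1 by apply: pI; lia.
  have h2 : p`_l.+1 <= p`_k by apply: pI; lia.
  have h3 : q`_l <= q`_k by apply: qI; lia.
  have h4 : p`_k <= p`_l by apply: pII; lia.
  have t1 : 0 <= k.+1%:R * (p`_k.+1 - p`_l) by rewrite mulr_ge0 ?subr_ge0.
  have t2 : 0 <= l.+1%:R * (p`_k - p`_l.+1) by rewrite mulr_ge0 ?subr_ge0.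
  have t3 : 0 <= b * (q`_k - q`_l) by rewrite mulr_ge0 ?subr_ge0.
  have t4 : 0 <= c * (p`_k.+1 - p`_l.+1).
    by rewrite mulr_ge0 // subr_ge0 (le_trans h2) // (le_trans h4).
  move: t1 t2 t3 t4; clear; clearbody b.
  move: (k.+1%:R : R) (l.+1%:R : R) p`_k p`_k.+1 p`_l p`_l.+1 q`_k q`_l.
  by move=> *; lra.
case/predU1P=> [->//|]; case: k => [|k].
  case: l => // l _; rewrite add0n => -[ln]; rewrite p'0 (p'S l 1) ?addn1 ?ln //.
  have h1 : p`_0 <= p`_l by apply: pII; lia.
  have t1 : 0 <= (c + l.+1%:R) * p`_l.+1 by rewrite mulr_ge0 ?addr_ge0.
  have t2 : 0 <= b * q`_l by rewrite mulr_ge0.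
  have t3 : 0 <= (1 - c) * p`_0 by rewrite mulr_ge0 ?subr_ge0.
  rewrite -ln; lra.
case: l => // l; rewrite ltnS => kl; rewrite addSn addnS => -[kln].
rewrite (p'S k l.+2) ?(p'S l k.+2); try lia.
have h1 : p`_k.+1 <= p`_l by apply: pII; lia.
have h2 : p`_k <= p`_l.+1 by apply: pII; lia.
have h3 : q`_k <= q`_l by apply: qII; lia.
have h4 : p`_l.+1 <= p`_k.+1 by apply: pI; lia.
have t1 : 0 <= k.+2%:R * (p`_l - p`_k.+1) by rewrite mulr_ge0 ?subr_ge0.
have t2 : 0 <= l.+2%:R * (p`_l.+1 - p`_k) by rewrite mulr_ge0 ?subr_ge0.
have t3 : 0 <= b * (q`_l - q`_k) by rewrite mulr_ge0 ?subr_ge0.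
have t4 : 0 <= (1 - c) * (p`_k.+1 - p`_l.+1) by rewrite mulr_ge0 ?subr_ge0.
move: t1 t2 t3 t4; rewrite -(natr1 k.+1) -(natr1 l.+1); clear; clearbody b.
move: (k.+1%:R : R) (l.+1%:R : R) p`_k p`_k.+1 p`_l p`_l.+1 q`_k q`_l.
by move=> *; lra.
Qed.

Lemma alternating_coefs_fix_exc (R : realType) n (c : R) :
  0 <= c <= 1 -> alternating_coefs n (fix_exc_poly n c).
Proof.
move=> c01; have /andP[c0 c1] := c01.
suff [] : alternating_coefs n (fix_exc_poly n c) /\
  alternating_coefs n.+1 (fix_exc_poly n.+1 c) by [].
elim: n => [|n [IH0 IH1]].
  rewrite fix_exc_poly0 fix_exc_poly1; split; split=> k; rewrite ?coefC.
  - by case: eqP.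
  - by case: k => [|k] [|l] //= _ _; rewrite coefC.
  - by [].
  - by case: eqP.
  - by case: k => [|[|k]] [|[|l]] //= _ _; rewrite !coefC.
  - by case: k => [|k] [|l] //= _ _; rewrite !coefC.
split=> //; rewrite fix_exc_poly_rec.
apply: alternating_coefs_step => //; first exact: size_fix_exc_poly.
case: n {IH0 IH1} => [|n]; last by rewrite (leq_trans (size_fix_exc_poly _ c01)).
by rewrite fix_exc_poly0 size_polyC; case: (1 != 0).
Qed.

Lemma reversalE (R : realType) n (p : {poly R}) :
  reversal n p = \poly_(i < n.+1) p`_(n - i).
Proof.
rewrite /reversal poly_def (reindex_inj rev_ord_inj); apply: eq_bigr => i _ /=.
by rewrite !subSS subKn // -ltnS.
Qed.

Lemma reversalZ (R : realType) n (a : R) (p : {poly R}) :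
  reversal n (a *: p) = a *: reversal n p.
Proof.
by rewrite scaler_sumr; apply: eq_bigr => i _; rewrite coefZ scalerA.
Qed.

Lemma reversalK (R : realType) n (p : {poly R}) :
  (size p <= n.+1)%N -> reversal n (reversal n p) = p.
Proof.
move=> sp; apply/polyP => i; rewrite !reversalE !coef_poly.
case: ltnP => [i_n|ni]; last by rewrite nth_default // (leq_trans sp).
by rewrite ltnS leq_subr subKn.
Qed.

Lemma poly_eq_nonzero (R : realType) (p q : {poly R}) :
  (forall x, x != 0 -> p.[x] = q.[x]) -> p = q.
Proof.
move=> pq; apply/eqP; rewrite -subr_eq0; apply/eqP.
pose rs := [seq k.+1%:R : R | k <- iota 0 (size (p - q))].
apply: (@roots_geq_poly_eq0 _ _ rs); last by rewrite size_map size_iota.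
  apply/allP => x; case/mapP => k _ ->; apply/rootP.
  by rewrite hornerD hornerN pq ?subrr // pnatr_eq0.
rewrite map_inj_uniq ?iota_uniq // => i j /eqP.
by rewrite eqr_nat => /eqP[].
Qed.

(** Homogeneity absorbs [x ^+ n] into the weights [c], [1 / x], 1, giving [c x], 1, [x]; [perm_sumC]
    swaps the last two. *)
Lemma reversal_fix_exc (R : realType) n (c : R) : 0 <= c <= 1 ->
  reversal n (fix_exc_poly n c) = perm_sum n (c *: 'X) 'X 1.
Proof.
move=> c01; have sP : (size (fix_exc_poly n c) <= n.+1)%N.
  case: n => [|n]; last exact/leqW/size_fix_exc_poly.
  by rewrite fix_exc_poly0 size_polyC; case: (1 != 0).
apply: poly_eq_nonzero => x x0; rewrite horner_reversal // horner_fix_exc_poly.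
rewrite -[RHS]/(horner_eval x _) rmorph_perm_sum /= /horner_eval.
rewrite hornerZ hornerX hornerC -perm_sumM divff // mulr1 perm_sumC mulrC.
by [].
Qed.

(** The colors at distinct points are independent, so their sum factors. A fixed point has [r]
    admissible colors, each making it an excedance; any other point has all [r.+1]. *)
Lemma derangement_polyE (R : realType) n r :
  derangement_poly R n r.+1 =
  perm_sum n (r%:R * 'X) (r.+1%:R * 'X) (r.+1%:R : {poly R}).
Proof.
rewrite /derangement_poly /perm_sum.
(* The value 0 at a fixed point of color 0 removes the non-derangements. *)
pose F (t : 'S_n) (k : 'I_n) (j : 'I_r.+1) : {poly R} :=
  if (t k == k) && (j == 0%N :> nat) then 0
  else 'X^((k < t k)%N || (t k == k) && (0 < j)%N).
transitivity (\sum_(t : 'S_n) \sum_(z : {ffun 'I_n -> 'I_r.+1}) \prod_k F t k (z k)).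
  rewrite pair_big /= big_mkcond /=; apply: eq_bigr => -[t z] _ /=.
  rewrite /is_derangement; case: ifPn => [|/negPn/existsP[k /= kP]].
    rewrite negb_exists => /forallP nP.
    rewrite /exc -sum1_card big_mkcond /= -prodrXr; apply: eq_bigr => k _.
    by rewrite /F (negPf (nP k)) inE /is_excedance /=; case: ifP.
  by rewrite (bigD1 k) //= {1}/F kP mul0r.
apply: eq_bigr => t _; rewrite -(bigA_distr_bigA (F t)); apply: eq_bigr => k _.
rewrite /F /step_weight; case: eqP => [tk|_] /=.
  rewrite big_ord_recl /= add0r tk ltnn /= sumr_const card_ord expr1 mulr_natl.
  by [].
rewrite sumr_const card_ord orbF.
by case: ifP => _; rewrite ?expr1 ?expr0 ?mulr_natl.
Qed.

Lemma derangement_poly_fix_exc (R : realType) n r : (0 < r)%N ->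
  let c : R := r.-1%:R / r%:R in 0 <= c <= 1 /\
  derangement_poly R n r = r%:R ^+ n *: reversal n (fix_exc_poly n c).
Proof.
case: r => // r _ c; have r0 : (0 : R) < r.+1%:R by rewrite ltr0n.
have c01 : 0 <= c <= 1.
  by rewrite divr_ge0 ?ler0n //= ler_pdivrMr // mul1r ler_nat.
split=> //; rewrite derangement_polyE reversal_fix_exc // -mul_polyC polyC_exp.
rewrite -perm_sumM polyC_natr mulr1; congr (perm_sum _ _ _ _).
rewrite -[c *: _]mul_polyC mulrA; congr (_ * _).
by rewrite -(polyC_natr _ r.+1) -(polyC_natr _ r) -polyCM mulrC divfK ?gt_eqF.
Qed.

(** * Self-reciprocal zeros and interlacing *)

(** At [c = 1] the recurrence is the Eulerian one, which preserves palindromic coefficients. *)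
Lemma coef_fix_exc1 (R : realType) n k : (k <= n)%N ->
  (fix_exc_poly n.+1 (1 : R))`_k = (fix_exc_poly n.+1 1)`_(n - k).
Proof.
have c01 : 0 <= (1 : R) <= 1 by rewrite ler01 lexx.
elim: n k => [|n IHn] k; first by rewrite leqn0 => /eqP->.
have top : (fix_exc_poly n.+1 (1 : R))`_n.+1 = 0.
  by rewrite nth_default // size_fix_exc_poly.
have end_eq : (fix_exc_poly n.+2 (1 : R))`_0 = (fix_exc_poly n.+2 1)`_n.+1.
  rewrite fix_exc_poly_rec coef0_euler_step coefS_euler_step subrr !mul0r addr0.
  rewrite top mulr0 add0r -[X in X - _]natr1 addrAC subrr add0r.
  by rewrite mul1r IHn // subn0 mul1r.
case: k => [|k]; first by rewrite subn0.
rewrite ltnS leq_eqVlt => /predU1P[->|kn]; first by rewrite subnn.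
have [l ln] : exists l, n = (k + l.+1)%N by exists (n - k.+1)%N; lia.
rewrite (_ : n.+1 - k.+1 = l.+1)%N; last by lia.
rewrite fix_exc_poly_rec !coefS_euler_step subrr !mul0r !addr0.
rewrite (IHn k.+1) // (IHn k) ?(ltnW kn) //.
have -> : (n - k.+1 = l)%N by rewrite ln addnS -addSn addKn.
have -> : (n - k = l.+1)%N by rewrite ln addKn.
rewrite addrC {}ln -!nat1r; congr (_ * _ + _ * _).
  by rewrite natrD -!nat1r; move: (k%:R : R) (l%:R : R) => x y; ring.
by rewrite natrD -!nat1r; move: (k%:R : R) (l%:R : R) => x y; ring.
Qed.

Lemma reversal_eulerian (R : realType) n :
  reversal n (fix_exc_poly n.+1 (1 : R)) = fix_exc_poly n.+1 1.
Proof.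
have c01 : 0 <= (1 : R) <= 1 by rewrite ler01 lexx.
apply/polyP => k; rewrite reversalE coef_poly; case: ltnP => kn.
  by rewrite -coef_fix_exc1.
by rewrite nth_default // (leq_trans (size_fix_exc_poly n c01)).
Qed.

(** The center of symmetry is [n / 2] here, against [(n - 1) / 2] for the Eulerian polynomial of the
    same index. *)
Lemma reversal_fix_exc0 (R : realType) n :
  reversal n (fix_exc_poly n (0 : R)) = fix_exc_poly n 0.
Proof.
by rewrite reversal_fix_exc ?lexx ?ler01 // scale0r /fix_exc_poly polyC0.
Qed.

Lemma root_reversal (R : realType) n (p : {poly R}) x :
  (size p <= n.+1)%N -> x != 0 -> p.[x] = 0 -> (reversal n p).[x^-1] = 0.
Proof.
by move=> sp x0 px; rewrite horner_reversal ?invr_neq0 // invrK px mulr0.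
Qed.

Lemma increasing_upto_inv (R : realType) m (y : nat -> R) :
  increasing_upto m y -> (forall i, (i < m)%N -> y i < 0) ->
  increasing_upto m (fun i => (y (m - i.+1)%N)^-1).
Proof.
move=> y_inc y0 i j ij jm; rewrite ltf_nV2 ?negrE ?y0 ?y_inc //; lia.
Qed.

Lemma zeros_eulerian (R : realType) m (y : nat -> R) :
  simple_zeros (fix_exc_poly m.+1 1) m y -> (forall i, (i < m)%N -> y i < 0) ->
  forall i, (i < m)%N -> (y (m - i.+1)%N)^-1 = y i.
Proof.
move=> py y0; have [y_inc l0 _] := py; have sp := simple_zeros_size py.
apply: (@simple_zeros_unique R (fix_exc_poly m.+1 1) m) => //.
apply: simple_zerosP => //; first exact: increasing_upto_inv.
move=> i im; rewrite -reversal_eulerian root_reversal ?sp //.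
  by rewrite lt_eqF // y0 //; lia.
by apply: (simple_zeros_root py); lia.
Qed.

(** The last zero, 0, has no inverse and is set apart: inversion reverses only the [m] negative
    zeros. *)
Lemma zeros_derangement (R : realType) m (y : nat -> R) :
  simple_zeros (fix_exc_poly m.+2 0) m.+1 y -> y m = 0 ->
  (forall i, (i < m)%N -> y i < 0) ->
  forall i, (i < m)%N -> (y (m - i.+1)%N)^-1 = y i.
Proof.
move=> py ym y0; have [y_inc l0 _] := py; have sp := simple_zeros_size py.
pose u i := if (i < m)%N then (y (m - i.+1)%N)^-1 else 0.
suff uy : simple_zeros (fix_exc_poly m.+2 0) m.+1 u.
  move=> i im; have := simple_zeros_unique uy py (ltnW im : (i < m.+1)%N).
  by rewrite /u im.
apply: simple_zerosP => //.
  move=> i j ij jm; rewrite /u (leq_trans ij jm); case: ifP => jm'.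
    apply: (@increasing_upto_inv R m y _ y0) => // a b ab bm.
    by apply: y_inc => //; apply: ltnW.
  by rewrite invr_lt0 y0 //; lia.
move=> i im; rewrite /u; case: ifP => im'.
  rewrite -reversal_fix_exc0 root_reversal ?sp ?leqnSn //.
    by rewrite lt_eqF // y0 //; lia.
  by apply: (simple_zeros_root py); lia.
by rewrite -[X in _.[X]]ym (simple_zeros_root py).
Qed.

(** Reversal in degree [m.+1], one above the degree of [p], adds the zero 0, which exceeds all the
    negative inverses. *)
Lemma reversal_zeros (R : realType) m (p : {poly R}) f :
  simple_zeros p m f -> (forall i, (i < m)%N -> f i < 0) -> 0 < p.[0] ->
  simple_zeros (reversal m.+1 p) m.+1
    (fun i => if (i < m)%N then (f (m - i.+1)%N)^-1 else 0).
Proof.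
move=> pf f0 p0; have [f_inc l0 _] := pf; have sp := simple_zeros_size pf.
have cq k : (reversal m.+1 p)`_k = if (k <= m.+1)%N then p`_(m.+1 - k) else 0.
  by rewrite reversalE coef_poly ltnS.
have q0 : 0 < (reversal m.+1 p)`_m.+1 by rewrite cq leqnn subnn -horner_coef0.
have sq : size (reversal m.+1 p) = m.+2.
  apply/eqP; rewrite eqn_leq reversalE size_poly /= -reversalE ltnNge.
  by apply/negP => /leq_sizeP/(_ m.+1 (leqnn _)) e; rewrite e ltxx in q0.
apply: simple_zerosP; rewrite ?lead_coefE ?sq //.
  move=> i j ij jm; rewrite (leq_trans ij jm); case: ifP => jm'.
    exact: increasing_upto_inv.
  by rewrite invr_lt0 f0 //; lia.
move=> i im; case: ifP => im'.
  rewrite root_reversal ?sp ?leqnSn //; first by rewrite lt_eqF // f0 //; lia.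
  by apply: (simple_zeros_root pf); lia.
by rewrite horner_coef0 cq subn0 nth_default // sp.
Qed.

Definition interlaced (R : realType) (m : nat) (f g : nat -> R) : Prop :=
  forall i, (i < m)%N -> g i <= f i <= g i.+1.

(* Decreasing [c] from 1 to 0 moves the zeros of [fix_exc_poly n c] up from the
   zeros of the Eulerian polynomial to those of the derangement polynomial; both
   end configurations are self-reciprocal. *)
Lemma fix_exc_interlaced (R : realType) m (c : R) : 0 < c -> c <= 1 ->
  exists f g, [/\ simple_zeros (fix_exc_poly m.+1 c) m f,
    simple_zeros (reversal m.+1 (fix_exc_poly m.+1 c)) m.+1 g
    & interlaced m f g].
Proof.
move=> c0 c1; have [f [pf f0 p0 _]] := fix_exc_zeros_gt0 c0 c1 m.
exists f; eexists; split; [exact: pf|exact: reversal_zeros pf f0 p0|].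
case: m pf f0 p0 => [//|m] pf f0 p0 i im; rewrite im.
have [a [pa a0 _ _]] := fix_exc_zeros_gt0 ltr01 (lexx (1 : R)) m.+1.
have [d [pd dm d0 _]] := fix_exc_zeros_eq0 R m.
have af j : (j < m.+1)%N -> a j <= f j.
  by apply: (fix_exc_zeros_antitone _ _ _ pf pa) => //; apply: ltW.
have fd j : (j < m.+1)%N -> f j <= d j.
  by apply: (fix_exc_zeros_antitone _ _ _ pd pf) => //; apply: ltW.
have rm : (m.+1 - i.+1 < m.+1)%N by lia.
(* With [j = m - i], the lower bound is [1 / f j <= 1 / a j = a i <= f i]. *)
apply/andP; split.
  apply: le_trans (af i im); rewrite -(zeros_eulerian pa a0 im).
  by rewrite lef_nV2 ?negrE ?a0 ?f0 // af.
case: ifP => im'; last by apply/ltW/f0.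
have im2 : (i < m)%N by [].
(* With [j = m - i.+1], the upper bound is [f i <= d i = 1 / d j <= 1 / f j]; the zero 0 of [d]
   causes the shift of the index. *)
apply: le_trans (fd i im) _; rewrite -(zeros_derangement pd dm d0 im2).
rewrite subSS; have rm2 : (m - i.+1 < m)%N by lia.
by rewrite lef_nV2 ?negrE ?d0 ?f0 ?fd // ltnW.
Qed.

(** * From interlaced simple zeros to the relation [prec] *)

Lemma simple_zerosZ (R : realType) (a : R) (p : {poly R}) m f :
  0 < a -> simple_zeros p m f -> simple_zeros (a *: p) m f.
Proof.
move=> a0 [f_inc l0 pE]; split=> //; rewrite lead_coefZ ?mulr_gt0 //.
by rewrite {1}pE scalerA.
Qed.

Lemma simple_zeros_real_rooted (R : realType) (p : {poly R}) m f :
  simple_zeros p m f -> real_rooted p.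
Proof.
case=> _ l0 ->; right=> z /rootP.
rewrite map_polyZ hornerZ rmorph_prod /= horner_prod => /eqP.
rewrite mulf_eq0 fmorph_eq0 gt_eqF //= => /prodf_eq0[i _].
rewrite rmorphB /= map_polyX map_polyC hornerXsubC subr_eq0 => /eqP-> //.
Qed.

Lemma simple_zeros_seq (R : realType) (p : {poly R}) m f :
  simple_zeros p m f -> is_zero_seq p (mkseq f m).
Proof.
case=> f_inc l0 pE; split.
  apply/(sortedP 0) => i; rewrite size_mkseq => im.
  by rewrite !nth_mkseq ?(ltnW im) //; apply/ltW/f_inc.
move=> x; rewrite pE -mul_polyC mupMr ?rootC ?gt_eqF //.
rewrite -(big_mkord xpredT (fun i => 'X - (f i)%:P)) /index_iota subn0.
by rewrite -(big_map f xpredT (fun y => 'X - y%:P)) mu_prod_XsubC.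
Qed.

Lemma prod_sign_ge0 (R : realType) (m k : nat) (f : nat -> R) (x : R) :
  (k <= m)%N -> (forall i, (i < k)%N -> f i <= x) ->
  (forall i, (k <= i < m)%N -> x <= f i) ->
  0 <= (-1) ^+ (m - k) * \prod_(i < m) (x - f i).
Proof.
move=> km fl fg; rewrite -(big_mkord xpredT (fun i => x - f i)).
rewrite (big_cat_nat (n := k)) //= mulrCA mulr_ge0 //.
  rewrite big_nat_cond; apply: prodr_ge0 => i /andP[/andP[_ ik] _].
  by rewrite subr_ge0 fl.
rewrite -(prodr_const_nat k m (-1)) -big_split /= big_nat_cond.
apply: prodr_ge0 => i /andP[kim _].
by rewrite mulN1r opprB subr_ge0 fg.
Qed.

(* By Lagrange interpolation [p = \sum_i w i *: q_ i] with [w i >= 0] and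
   [q = ('X - g i) * q_ i], and the Wronskian of [q_ i] and [q] is [- q_ i ^+ 2]. *)
Lemma interlaced_wronskian (R : realType) (p q : {poly R}) m f g x :
  simple_zeros p m f -> simple_zeros q m.+1 g -> interlaced m f g ->
  (p^`() * q - p * q^`()).[x] <= 0.
Proof.
move=> pf qg fg; have [f_inc lp _] := pf; have [g_inc lq qE] := qg.
have qs (i : 'I_m.+1) := simple_zeros_deriv_sign qg (ltn_ord i).
pose q_ (i : 'I_m.+1) := lead_coef q *: \prod_(j < m.+1 | j != i) ('X - (g j)%:P).
have q_E (i : 'I_m.+1) : q = ('X - (g i)%:P) * q_ i.
  by rewrite {1}qE (bigD1 i) //= scalerAr.
have q'E (i : 'I_m.+1) : q^`() = q_ i + ('X - (g i)%:P) * (q_ i)^`().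
  by rewrite {1}(q_E i) derivM derivXsubC mul1r.
have q_i (i : 'I_m.+1) : (q_ i).[g i] = q^`().[g i].
  by rewrite (q'E i) hornerD hornerM hornerXsubC subrr mul0r addr0.
have q_j (i j : 'I_m.+1) : j != i -> (q_ i).[g j] = 0.
  by move=> ji; rewrite hornerZ horner_prod (bigD1 j) //= hornerXsubC subrr mul0r mulr0.
pose w (i : 'I_m.+1) := p.[g i] / q^`().[g i].
have q'n (i : 'I_m.+1) : q^`().[g i] != 0.
  by apply/negP => /eqP e; have := qs i; rewrite e mulr0 ltxx.
have w0 i : 0 <= w i.
  (* By interlacing, [p] has weakly the sign of the derivative of [q] at [g i]. *)
  have ps : 0 <= (-1) ^+ (m - i) * p.[g i].
    rewrite (simple_zeros_horner _ pf) mulrCA; apply: mulr_ge0; first exact: ltW.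
    apply: prod_sign_ge0; first by rewrite -ltnS.
      move=> j ji; have jm : (j < m)%N by apply: leq_trans ji _; rewrite -ltnS.
      have /andP[_ fj] := fg j jm; apply: le_trans fj _.
      move: ji; rewrite leq_eqVlt => /predU1P[->//|ji].
      by apply/ltW/g_inc.
    move=> j /andP[ij jm]; have /andP[gj _] := fg j jm; apply: le_trans gj.
    move: ij; rewrite leq_eqVlt => /predU1P[->//|ij].
    by apply/ltW/g_inc => //; apply: ltnW.
  by rewrite /w -(pmulr_rge0 _ (qs i)) subSS -mulrA [p.[_] / _]mulrC mulVKf.
have pE : p = \sum_i w i *: q_ i.
  apply/eqP; rewrite -subr_eq0; apply/eqP.
  (* Both sides have degree at most [m] and agree at the [m.+1] distinct zeros of [q]. *)
  apply: (@roots_geq_poly_eq0 _ _ (mkseq g m.+1)).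
  - apply/allP => y; case/mapP => j; rewrite mem_iota /= => jm ->; apply/rootP.
    rewrite hornerD hornerN horner_sum (bigD1 (Ordinal jm)) //= big1 => [|i ij].
      rewrite hornerZ (q_i (Ordinal jm)) /w /= divfK ?(q'n (Ordinal jm)) //.
      by rewrite addr0 subrr.
    by rewrite hornerZ (q_j i (Ordinal jm)) ?mulr0 // eq_sym.
  - rewrite map_inj_in_uniq ?iota_uniq // => i j; rewrite !mem_iota /= => im jm gij.
    case: (ltngtP i j) => // ij; have := g_inc _ _ ij; rewrite gij ltxx.
      by move=> /(_ jm).
    by move=> /(_ im).
  rewrite size_mkseq; apply/leq_sizeP => k mk; rewrite coefB coef_sum.
  rewrite nth_default ?(simple_zeros_size pf) // big1 ?subrr // => i _.
  rewrite coefZ nth_default ?mulr0 //; apply: leq_trans mk.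
  have q_0 : q_ i != 0.
    apply/eqP => e; have := q_E i; rewrite e mulr0 => q0.
    by move: lq; rewrite q0 lead_coef0 ltxx.
  have := simple_zeros_size qg; rewrite (q_E i) size_monicM ?monicXsubC //.
  by rewrite size_XsubC !addSn add0n => -[->].
have -> : p^`() * q - p * q^`() = - \sum_i w i *: (q_ i ^+ 2).
  rewrite pE raddf_sum /= !big_distrl /= -sumrB -sumrN; apply: eq_bigr => i _.
  rewrite derivZ (q'E i) {1}(q_E i) -!mul_polyC; ring.
rewrite hornerN horner_sum oppr_le0 sumr_ge0 // => i _.
by rewrite hornerZ horner_exp mulr_ge0 ?sqr_ge0.
Qed.

Lemma interlaced_prec (R : realType) (p q : {poly R}) m f g :
  simple_zeros p m f -> simple_zeros q m.+1 g -> interlaced m f g -> prec p q.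
Proof.
move=> pf qg fg; split; [exact: simple_zeros_real_rooted pf|
  exact: simple_zeros_real_rooted qg|apply: Or33].
split; last by move=> x; apply: interlaced_wronskian pf qg fg.
exists (mkseq f m), (mkseq g m.+1).
split; [exact: simple_zeros_seq|exact: simple_zeros_seq| |].
  (* The zero [g i.+1] lies between [f i] and [f i.+1], so the inner zeros [g 1, ..., g (m - 1)]
     serve. *)
  exists (mkseq (fun i => g i.+1) m.-1); rewrite !size_mkseq; split=> //.
    have -> : mkseq g m.+1 = g 0 :: mkseq (fun i => g i.+1) m.
      by rewrite /mkseq /= -[1%N]addn0 iotaDl -map_comp.
    apply: subseq_trans (subseq_cons _ _).
    case: m {fg pf qg} => [|m]; first exact: sub0seq.
    by rewrite mkseqS subseq_rcons.
  move=> i im; rewrite !nth_mkseq ?(ltnW im) //; last by lia.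
  have /andP[_ ->] := fg i (ltnW im).
  by have /andP[-> _] := fg i.+1 im.
exists (mkseq f m); rewrite !size_mkseq; split=> // i; rewrite ltnS => im.
by rewrite !nth_mkseq ?ltnS ?(ltnW im) //; apply: fg.
Qed.

Lemma simple_zeros_prec_refl (R : realType) (p : {poly R}) m f :
  simple_zeros p m f -> prec p p.
Proof.
move=> pf; have rp := simple_zeros_real_rooted pf; split=> //; apply: Or33.
split; last by move=> x; rewrite mulrC subrr horner0.
have sp := simple_zeros_seq pf; exists (mkseq f m), (mkseq f m).
have [f_inc _ _] := pf.
have ss : separated_by (mkseq f m) (mkseq f m).
  exists (mkseq f m.-1); rewrite !size_mkseq; split=> //.
    by case: (m) => [|k]; rewrite ?mkseqS ?subseq_rcons.
  move=> i im; rewrite !nth_mkseq ?(ltnW im) //; last by lia.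
  by rewrite lexx ltW // f_inc.
by split.
Qed.

Lemma derangement_alternatingly_increasing (R : realType) n r : (0 < r)%N ->
  alternatingly_increasing n (derangement_poly R n r).
Proof.
move=> r0; have [c01 ->] := derangement_poly_fix_exc R n r0.
set c := _ / _ in c01 *; have [p0 pI pII] := alternating_coefs_fix_exc n c01.
rewrite -reversalZ; have a0 : (0 : R) <= r%:R ^+ n by rewrite exprn_ge0.
set q := reversal _ _.
have qE k : (k <= n)%N -> q`_k = r%:R ^+ n * (fix_exc_poly n c)`_(n - k).
  by move=> kn; rewrite /q reversalE coef_poly ltnS kn coefZ.
split; first by rewrite /q reversalE size_poly.
rewrite /=; apply/andP; split.
  by rewrite qE // mulr_ge0.
apply/(pathP 0) => i; rewrite size_map size_iota => i_n.
rewrite (nth_map 0%N) ?size_iota // nth_iota // add1n.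
have -> : (q`_(alt_index n 0) :: [seq q`_(alt_index n k) | k <- iota 1 n])`_i =
    q`_(alt_index n i).
  rewrite -[_ :: _]/([seq q`_(alt_index n k) | k <- iota 0 n.+1]).
  by rewrite (nth_map 0%N) ?size_iota ?nth_iota ?add0n // ltnW.
(* With [h = i./2], an odd [i] compares the unreversed coefficients at [h] and [n - h - 1], an even
   [i] those at [n - h] and [h]. *)
rewrite /alt_index /=; have := odd_double_half i; rewrite uphalf_half.
case: (odd i) => /= iE; rewrite !qE; try lia; apply: ler_wpM2l => //.
  by apply: pII; lia.
by apply: pI; lia.
Qed.

Theorem theorem3p8 (R : realType) (n r : nat) (hn : (0 < n)%N) (hr : (0 < r)%N) :
  prec (reversal n (derangement_poly R n r)) (derangement_poly R n r) /\
  real_rooted (derangement_poly R n r) /\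
  alternatingly_increasing n (derangement_poly R n r).
Proof.
suff H : prec (reversal n (derangement_poly R n r)) (derangement_poly R n r).
  split=> //; split; last exact: derangement_alternatingly_increasing.
  by case: H.
have [c01 dE] := derangement_poly_fix_exc R n hr.
rewrite {}dE reversalZ; set c := _ / _ in c01 *.
case: n hn => // m _; have a0 : (0 : R) < r%:R ^+ m.+1 by rewrite exprn_gt0 ?ltr0n.
rewrite reversalK; last exact/leqW/size_fix_exc_poly.
case/andP: c01; rewrite le_eqVlt => /predU1P[<- _|c0 c1]; last first.
  have [f [g [pf qg fg]]] := fix_exc_interlaced m c0 c1.
  exact: interlaced_prec (simple_zerosZ a0 pf) (simple_zerosZ a0 qg) fg.
(* Here [c = 0], that is [r = 1]: the polynomial is its own reversal, and it is zero for [n = 1]. *)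
rewrite reversal_fix_exc0; case: m a0 => [|m] a0.
  by rewrite fix_exc_poly1 scaler0; split; [left|left|apply: Or31].
have [d [pd _ _ _]] := fix_exc_zeros_eq0 R m.
exact: simple_zeros_prec_refl (simple_zerosZ a0 pd).
Qed.
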